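(* Let $X$ be a Hadamard space with linear dual space $X^{\lozenge}$, let $p\in X$, and let $h\in\Gamma_p^{\lozenge}(X)$. Then the set-valued operator $S_{h,p}:X\multimap X^{\lozenge}$, $S_{h,p}(x):=\{x^{\lozenge}\in X^{\lozenge}:h(x,x^{\lozenge})=\pi_p(x,x^{\lozenge})\}$, is maximal monotone.
   Context: A Hadamard space is a (nonempty) complete $\mathrm{CAT}(0)$ space $(X,d)$. For $x,y\in X$ and $t\in[0,1]$, $(1-t)x\oplus ty$ denotes the point $c(t)$ of the unique constant-speed geodesic $c:[0,1]\to X$ from $x$ to $y$. Quasilinearization: for $x,y,u,v\in X$, $\langle\overrightarrow{xy},\overrightarrow{uv}\rangle:=\frac12\big(d(x,v)^2+d(y,u)^2-d(x,u)^2-d(y,v)^2\big)$. Dual spaces: for $t\in\mathbb R$, $a,b\in X$, $[t\overrightarrow{ab}]$ is the class of $(t,a,b)\in\mathbb R\times X^2$ under the relation $(t,a,b)\sim(s,c,d)$ iff $t\langle\overrightarrow{ab},\overrightarrow{xy}\rangle=s\langle\overrightarrow{cd},\overrightarrow{xy}\rangle$ for all $x,y\in X$; it is identified with the function $\overrightarrow{xy}\mapsto t\langle\overrightarrow{ab},\overrightarrow{xy}\rangle$ on $X^2$. $X^*$ is the set of all such classes, and the linear dual $X^{\lozenge}$ is the real vector space of all finite linear combinations $\sum_i\alpha_i x_i^*$ ($\alpha_i\in\mathbb R$, $x_i^*\in X^*$), acting on $X^2$ by $\langle\sum_i\alpha_ix_i^*,\overrightarrow{xy}\rangle=\sum_i\alpha_i\langle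 x_i^*,\overrightarrow{xy}\rangle$ (elements with the same action are equal). $X^{\lozenge}$ carries the norm $\|x^{\lozenge}\|_{\lozenge}=\sup\Big\{\frac{|\langle x^{\lozenge},\overrightarrow{ab}\rangle-\langle x^{\lozenge},\overrightarrow{cd}\rangle|}{d(a,b)+d(c,d)}: a,b,c,d\in X,\ (a,c)\ne(b,d)\Big\}$, and $X\times X^{\lozenge}$ the product topology. For $h:X\times X^{\lozenge}\to[-\infty,\infty]$: $h$ is proper if it never takes the value $-\infty$ and $h\not\equiv\infty$; l.s.c. if its epigraph is closed; convex if $h((1-\lambda)x\oplus\lambda y,(1-\lambda)x^{\lozenge}+\lambda y^{\lozenge})\le(1-\lambda)h(x,x^{\lozenge})+\lambda h(y,y^{\lozenge})$ for all $(x,x^{\lozenge}),(y,y^{\lozenge})$ and $\lambda\in[0,1]$. $\Gamma(X\times X^{\lozenge})$ is the set of proper, l.s.c., convex $h:X\times X^{\lozenge}\to[-\infty,\infty]$. Fix $p\in X$. $\pi_p(x,x^{\lozenge}):=\langle x^{\lozenge},\overrightarrow{px}\rangle$ on $X\times X^{\lozenge}$; $r(x,x^{\lozenge}):=(x^{\lozenge},x)$. The indicator $\iota_A$ equals $0$ on $A$ and $\infty$ off $A$. $\{h\le\pi_p\}:=\{(x,x^{\lozenge}):h(x,x^{\lozenge})\le\pi_p(x,x^{\lozenge})\}$. The $p$-Fenchel conjugate $h_p^{\lozenge}:X^{\lozenge}\times X\to[-\infty,\infty]$ is $$h_p^{\lozenge}(x^{\lozenge},x)=\sup_{(y,y^{\lozenge})\in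 X\times X^{\lozenge}}\{\langle x^{\lozenge},\overrightarrow{py}\rangle+\langle y^{\lozenge},\overrightarrow{px}\rangle-h(y,y^{\lozenge})\}.$$ $\Gamma_p^{\lozenge}(X):=\{h\in\Gamma(X\times X^{\lozenge}): h=(h+\iota_{\{h\le\pi_p\}})_p^{\lozenge}\circ r\text{ on }X\times X^{\lozenge}\}$. For a set-valued operator $T:X\multimap X^{\lozenge}$ (a map assigning to each $x\in X$ a possibly empty subset $T(x)\subseteq X^{\lozenge}$), $\mathrm{gra}(T)=\{(x,x^{\lozenge}):x^{\lozenge}\in T(x)\}$. $T$ is monotone if $\langle x^{\lozenge}-y^{\lozenge},\overrightarrow{yx}\rangle\ge0$ for all $(x,x^{\lozenge}),(y,y^{\lozenge})\in\mathrm{gra}(T)$; it is maximal monotone if it is monotone and no monotone operator has a graph properly containing $\mathrm{gra}(T)$. *)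

(* Defs.v *)
From HB Require Import structures.
From mathcomp Require Import all_boot all_order all_algebra.
From mathcomp Require Import all_classical all_reals all_analysis.
From mathcomp Require Import ring lra.

Set Implicit Arguments.
Unset Strict Implicit.
Unset Printing Implicit Defensive.

Import Order.TTheory GRing.Theory Num.Theory.
Import numFieldNormedType.Exports.

Local Open Scope classical_set_scope.
Local Open Scope ring_scope.

Section plane.
Context {R : realType}.
Implicit Types u v : R * R.

(* The library's norm on R * R is the sup norm, hence the explicit Euclidean
   distance. *)
Definition edist u v : R :=
  Num.sqrt ((u.1 - v.1) ^+ 2 + (u.2 - v.2) ^+ 2).

Definition esegment u v (t : R) : R * R :=
  ((1 - t) * u.1 + t * v.1, (1 - t) * u.2 + t * v.2).

End plane.

Section geodesics.
Context {R : realType} {X : metricType R}.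
Implicit Types (x y z : X) (c : R -> X).

(* Constant-speed geodesic parametrised by [0, 1]; the values of c outside
   [0, 1] are irrelevant. *)
Definition geodesic c x y : Prop :=
  [/\ c 0 = x, c 1 = y &
    forall s t, 0 <= s <= 1 -> 0 <= t <= 1 ->
      mdist (c s) (c t) = `|s - t| * mdist x y].

(* (1 - t) x (+) t y; meaningful when the geodesic from x to y exists and is
   unique on [0, 1], as in a CAT(0) space. *)
Definition gcomb x y (t : R) : X :=
  xget (fun=> x) [set c | geodesic c x y] t.

Definition quasilin (xy uv : X * X) : R :=
  2^-1 * (mdist xy.1 uv.2 ^+ 2 + mdist xy.2 uv.1 ^+ 2
          - mdist xy.1 uv.1 ^+ 2 - mdist xy.2 uv.2 ^+ 2).

End geodesics.

Definition geodesic_space {R : realType} (X : metricType R) : Prop :=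
  forall x y : X, exists c, geodesic c x y.

(* Every geodesic triangle is at least as thin as its Euclidean comparison
   triangle (x', y', z'). Two distinct sides of a triangle share a vertex, so,
   up to relabelling, it suffices to compare points on the sides [x, y] and
   [x, z]. *)
Definition thin_triangles {R : realType} (X : metricType R) : Prop :=
  forall (x y z : X) (c1 c2 : R -> X) (x' y' z' : R * R),
    geodesic c1 x y -> geodesic c2 x z ->
    edist x' y' = mdist x y -> edist y' z' = mdist y z ->
    edist x' z' = mdist x z ->
    forall s t, 0 <= s <= 1 -> 0 <= t <= 1 ->
      mdist (c1 s) (c2 t) <= edist (esegment x' y' s) (esegment x' z' t).

Definition cat0_space {R : realType} (X : metricType R) : Prop :=
  geodesic_space X /\ thin_triangles X.

HB.mixin Record Metric_isCAT0 (R : realType) X & Metric R X := {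
  cat0P : cat0_space X
}.

(* Nonemptiness is part of the library's Complete structure. *)
#[short(type="hadamardType")]
HB.structure Definition Hadamard (R : realType) :=
  {X of Metric R X & Complete X & Metric_isCAT0 R X}.

Section quadrilateral.
Context {R : realType} (X : hadamardType R).
Implicit Types (a b c d : X).

Let dist := @mdist R X.

Lemma comparison_triangle (x y z : X) : exists x' y' z' : R * R,
  [/\ edist x' y' = mdist x y, edist y' z' = mdist y z &
      edist x' z' = mdist x z].
Proof.
have [xy|nxy] := eqVneq x y.
  exists (0, 0), (0, 0), (mdist x z, 0).
  by rewrite /edist /= -xy mdistxx !subrr !expr0n /= !addr0 sqrtr0 sub0r
    sqrrN sqrtr_sqr ger0_norm// mdist_ge0.
set l := mdist x y; set m := mdist x z; set n := mdist y z.
have l0 : 0 < l by rewrite mdist_gt0.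
have m0 : 0 <= m by exact: mdist_ge0.
have n0 : 0 <= n by exact: mdist_ge0.
have T1 : n <= l + m by rewrite /l metric_sym; exact: metric_triangle.
have T2 : m <= l + n by exact: metric_triangle.
have T3 : l <= m + n by rewrite /n metric_sym; exact: metric_triangle.
pose u := (l ^+ 2 + m ^+ 2 - n ^+ 2) / (2 * l).
have lu : 2 * l * u = l ^+ 2 + m ^+ 2 - n ^+ 2.
  by rewrite /u mulrC divfK// mulf_neq0 ?pnatr_eq0// gt_eqF.
have um : u ^+ 2 <= m ^+ 2.
  have um1 : u <= m.
    rewrite -(@ler_pM2l _ (2 * l)) ?mulr_gt0// lu -subr_ge0.
    have -> : 2 * l * m - (l ^+ 2 + m ^+ 2 - n ^+ 2) =
      (n - l + m) * (n + l - m) by ring.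
    by apply: mulr_ge0; lra.
  have um2 : - m <= u.
    rewrite -(@ler_pM2l _ (2 * l)) ?mulr_gt0// lu -subr_ge0.
    have -> : l ^+ 2 + m ^+ 2 - n ^+ 2 - 2 * l * - m =
      (l + m - n) * (l + m + n) by ring.
    by apply: mulr_ge0; lra.
  rewrite -subr_ge0 subr_sqr; apply: mulr_ge0; lra.
pose v := Num.sqrt (m ^+ 2 - u ^+ 2).
have v2 : v ^+ 2 = m ^+ 2 - u ^+ 2 by rewrite sqr_sqrtr// subr_ge0.
exists (0, 0), (l, 0), (u, v); rewrite /edist /= !sub0r !sqrrN expr0n /= addr0.
split; first by rewrite sqrtr_sqr ger0_norm// ltW.
- have -> : (l - u) ^+ 2 + v ^+ 2 = n ^+ 2.
    by rewrite v2; have := lu; nra.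
  by rewrite sqrtr_sqr ger0_norm.
- by rewrite v2 addrC subrK sqrtr_sqr ger0_norm.
Qed.

Lemma cat0_cn (a b d : X) (c : R -> X) (t : R) : 0 <= t <= 1 ->
  geodesic c b d ->
  mdist (c t) a ^+ 2 <= (1 - t) * mdist b a ^+ 2 + t * mdist d a ^+ 2
                        - t * (1 - t) * mdist b d ^+ 2.
Proof.
move=> t01 cbd; have [geoX thinX] := @cat0P R X.
have [c2 ba] := geoX b a.
have [b' [d' [a' [E1 E2 E3]]]] := comparison_triangle b d a.
have := thinX _ _ _ _ _ _ _ _ cbd ba E1 E2 E3 t 1 t01.
have -> : c2 1 = a by case: ba.
rewrite ler01 lexx => /(_ isT).
rewrite -(@ler_sqr _ (mdist _ _)) ?nnegrE ?mdist_ge0 ?sqrtr_ge0// => H.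
apply: (le_trans H); rewrite -E1 -E2 -E3 /edist /esegment /=.
rewrite !sqr_sqrtr ?addr_ge0 ?sqr_ge0//.
by rewrite le_eqVlt; apply/orP; left; apply/eqP; ring.
Qed.

Lemma quadrilateral a b c d :
  mdist a c ^+ 2 + mdist b d ^+ 2 <=
  mdist a d ^+ 2 + mdist b c ^+ 2 + 2 * (mdist a b * mdist c d).
Proof.
have [<-|nab] := eqVneq a b.
  by rewrite mdistxx mul0r mulr0 addr0 addrC.
have [<-|ncd] := eqVneq c d.
  by rewrite mdistxx mulr0 mulr0 addr0 addrC.
set p := mdist a b; set q := mdist c d.
have p0 : 0 < p by rewrite mdist_gt0.
have q0 : 0 < q by rewrite mdist_gt0.
pose t := p / (p + q).
have pq0 : p + q != 0 by rewrite gt_eqF// addr_gt0.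
have tpq : t * (p + q) = p by rewrite divfK.
have t0 : 0 < t by rewrite divr_gt0// addr_gt0.
have t1 : t < 1 by rewrite ltr_pdivrMr ?addr_gt0// mul1r ltrDl.
have t01 : 0 <= t <= 1 by rewrite !ltW.
have [geoX _] := @cat0P R X; have [g gbd] := geoX b d.
have Ha := cat0_cn a t01 gbd; have Hc := cat0_cn c t01 gbd.
have tri : mdist a c <= mdist (g t) a + mdist (g t) c.
  by rewrite (metric_sym (g t) a); exact: metric_triangle.
move: Ha Hc tri; rewrite (metric_sym b a) (metric_sym d a) (metric_sym d c).
rewrite -/p -/q.
have := mdist_ge0 a c; have := mdist_ge0 (g t) a; have := mdist_ge0 (g t) c.
move: (mdist a c) (mdist (g t) a) (mdist (g t) c) (mdist a d) (mdist b c)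
  (mdist b d) => ac ga gc ad bc bd gc0 ga0 ac0 Ha Hc tri.
have W : t * (1 - t) * ac ^+ 2 <= (1 - t) * ga ^+ 2 + t * gc ^+ 2.
  have : ac ^+ 2 <= (ga + gc) ^+ 2 by rewrite ler_sqr ?nnegrE// addr_ge0.
  have tt : 0 <= t * (1 - t) by rewrite mulr_ge0; lra.
  move=> /(ler_wpM2l tt) /le_trans; apply.
  rewrite -subr_ge0.
  have -> : (1 - t) * ga ^+ 2 + t * gc ^+ 2 - t * (1 - t) * (ga + gc) ^+ 2 =
    ((1 - t) * ga - t * gc) ^+ 2 by ring.
  exact: sqr_ge0.
have H1 : t * (1 - t) * ac ^+ 2 <= t * (1 - t) *
    (ad ^+ 2 + bc ^+ 2 - bd ^+ 2) + (1 - t) ^+ 2 * p ^+ 2 + t ^+ 2 * q ^+ 2.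
  have ut : 0 <= 1 - t by lra.
  have := ler_wpM2l ut Ha; have := ler_wpM2l (ltW t0) Hc; nra.
have E : t * q = (1 - t) * p by lra.
have E2 : (1 - t) ^+ 2 * p ^+ 2 + t ^+ 2 * q ^+ 2 = t * (1 - t) * (2 * (p * q)).
  have -> : (1 - t) ^+ 2 * p ^+ 2 = ((1 - t) * p) * ((1 - t) * p) by ring.
  have -> : t ^+ 2 * q ^+ 2 = (t * q) * (t * q) by ring.
  have -> : t * (1 - t) * (2 * (p * q)) = 2 * ((t * q) * ((1 - t) * p)) by ring.
  by rewrite E; ring.
have tt : 0 < t * (1 - t) by rewrite mulr_gt0// subr_gt0.
have : ac ^+ 2 <= ad ^+ 2 + bc ^+ 2 - bd ^+ 2 + 2 * (p * q).
  by rewrite -(ler_pM2l tt) [leRHS]mulrDr -E2 addrA.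
lra.
Qed.

Lemma quasilin_CS (xy uv : X * X) :
  `|quasilin xy uv| <= mdist xy.1 xy.2 * mdist uv.1 uv.2.
Proof.
case: xy uv => x y [u v]; rewrite /quasilin /=.
have H1 := quadrilateral x y v u; have H2 := quadrilateral x y u v.
rewrite (metric_sym v u) in H1.
rewrite ler_norml; apply/andP; split; lra.
Qed.

End quadrilateral.

Section dual.
Context {R : realType} (X : hadamardType R).

(* X*: the class [t ab] is identified with its action on pairs. *)
Definition dual : set (X * X -> R^o) :=
  [set f | exists (t : R) (ab : X * X), f = fun xy => t * quasilin ab xy].

Definition dual_span : set (X * X -> R^o) :=
  [set f | exists n (a : 'I_n -> R) (g : 'I_n -> X * X -> R^o),
     (forall i, dual (g i)) /\ f = \sum_i a i *: g i].

Definition linear_dual_pred : {pred X * X -> R^o} := mem dual_span.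

Lemma linear_dual_submod_closed : submod_closed linear_dual_pred.
Proof.
split.
  rewrite inE; exists 0, (fun=> 0), (fun=> 0).
  by split; [case|rewrite big_ord0].
move=> l f1 f2; rewrite !inE => -[n [a [g [gd ->]]]] [m [b [k [kd ->]]]].
exists (n + m)%N.
exists (fun i => match fintype.split i with inl j => l * a j | inr j => b j end).
exists (fun i => match fintype.split i with inl j => g j | inr j => k j end).
split; first by move=> i; case: (fintype.split i).
rewrite big_split_ord /= scaler_sumr; congr (_ + _); apply: eq_bigr => i _.
  by rewrite (unsplitK (inl i)) scalerA.
by rewrite (unsplitK (inr i)).
Qed.

HB.instance Definition _ :=
  GRing.isSubmodClosed.Build R (X * X -> R^o) linear_dual_pred
    linear_dual_submod_closed.

Record linear_dual := LinearDual {
  linear_dual_val : X * X -> R^o ;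
  _ : linear_dual_val \in linear_dual_pred }.

HB.instance Definition _ := [isSub for linear_dual_val].
HB.instance Definition _ := [Choice of linear_dual by <:].
HB.instance Definition _ := [SubChoice_isSubLmodule of linear_dual by <:].

Definition pairing (f : linear_dual) (xy : X * X) : R := linear_dual_val f xy.

(* The supremum is finite by quasilin_CS. If X is a singleton, the set is empty
   and its supremum is 0 in the library. *)
Definition dual_norm (f : linear_dual) : R :=
  sup [set r | exists a b c d : X, (a, c) <> (b, d) /\
    r = `|pairing f (a, b) - pairing f (c, d)| / (mdist a b + mdist c d)].

Lemma pairingD f g xy : pairing (f + g) xy = pairing f xy + pairing g xy.
Proof. by []. Qed.

Lemma pairingN f xy : pairing (- f) xy = - pairing f xy.
Proof. by []. Qed.

Lemma pairingB f g xy : pairing (f - g) xy = pairing f xy - pairing g xy.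
Proof. by []. Qed.

Lemma pairingZ (l : R) f xy : pairing (l *: f) xy = l * pairing f xy.
Proof. by []. Qed.

Lemma pairing_ext f g : pairing f =1 pairing g -> f = g.
Proof. by move=> fg; apply: val_inj; apply: funext => xy; exact: fg. Qed.

Lemma pairing_bounded f : exists2 M : R, 0 <= M &
  forall a b, `|pairing f (a, b)| <= M * mdist a b.
Proof.
case: f => f /=; rewrite inE => -[n [a [g [gd fE]]]]; rewrite /pairing /= fE.
elim: n a g gd {f fE} => [|n IH] a g gd.
  by exists 0 => // x y; rewrite big_ord0 mul0r normr0.
have [M M0 HM] := IH (fun i => a (lift ord0 i)) (fun i => g (lift ord0 i))
  (fun i => gd _).
have [t [ab gE]] := gd ord0.
exists (`|a ord0| * (`|t| * mdist ab.1 ab.2) + M).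
  by rewrite addr_ge0// !mulr_ge0// mdist_ge0.
move=> x y; rewrite big_ord_recl mulrDl.
apply: (le_trans (ler_normD _ _)); apply: lerD; last exact: HM.
rewrite gE.
change (`|a ord0 * (t * quasilin ab (x, y))| <=
  `|a ord0| * (`|t| * mdist ab.1 ab.2) * mdist x y).
move: (quasilin_CS ab (x, y)) => /=; move: (quasilin _ _) => r rle.
by rewrite !normrM -!mulrA ler_wpM2l// ler_wpM2l.
Qed.

Lemma mdistD_gt0 (a b c d : X) : (a, c) <> (b, d) ->
  0 < mdist a b + mdist c d.
Proof.
move=> ne; have [ab|nab] := eqVneq a b.
  rewrite ab mdistxx add0r mdist_gt0; apply/eqP => cd; apply: ne.
  by rewrite ab cd.
by rewrite ltr_pwDl ?mdist_ge0// mdist_gt0.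
Qed.

Lemma dual_norm_ub f (a b c d : X) : (a, c) <> (b, d) ->
  `|pairing f (a, b) - pairing f (c, d)| / (mdist a b + mdist c d)
  <= dual_norm f.
Proof.
move=> ne; apply: ub_le_sup; last by exists a, b, c, d.
have [M M0 HM] := pairing_bounded f; exists M => _ [a' [b' [c' [d' [ne' ->]]]]].
rewrite ler_pdivrMr ?mdistD_gt0// mulrDr.
by apply: (le_trans (ler_normB _ _)); apply: lerD.
Qed.

Lemma dual_norm_le f (M : R) : 0 <= M ->
  (forall a b c d : X, (a, c) <> (b, d) ->
    `|pairing f (a, b) - pairing f (c, d)| / (mdist a b + mdist c d) <= M) ->
  dual_norm f <= M.
Proof.
move=> M0 HM; rewrite /dual_norm; set A := [set _ | _].
have [->|/set0P A0] := eqVneq A set0; first by rewrite sup0.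
by apply: ge_sup => // _ [a [b [c [d [ne ->]]]]]; exact: HM.
Qed.

Lemma dual_norm_ge0 f : 0 <= dual_norm f.
Proof.
have [[a [b ab]]|/forallNP X1] := pselect (exists a b : X, a <> b).
  have ne : (a, a) <> (b, b) by case.
  apply: le_trans (dual_norm_ub f ne).
  by rewrite divr_ge0// ltW// mdistD_gt0.
have X1E (a b : X) : a = b.
  by have /forallNP/(_ b)/contrapT := X1 a.
rewrite /dual_norm [X in sup X](_ : _ = set0) ?sup0//.
rewrite -subset0 => r [a [b [c [d [ne _]]]]]; apply: ne.
by congr (_, _); exact: X1E.
Qed.

Lemma dual_normD f g : dual_norm (f + g) <= dual_norm f + dual_norm g.
Proof.
apply: dual_norm_le => [|a b c d ne]; first by rewrite addr_ge0// dual_norm_ge0.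
apply: le_trans (lerD (dual_norm_ub f ne) (dual_norm_ub g ne)).
rewrite -mulrDl ler_wpM2r ?invr_ge0 ?(ltW (mdistD_gt0 ne))//.
by rewrite !pairingD opprD addrACA ler_normD.
Qed.

Lemma dual_normZ_le (l : R) f : dual_norm (l *: f) <= `|l| * dual_norm f.
Proof.
apply: dual_norm_le => [|a b c d ne]; first by rewrite mulr_ge0// dual_norm_ge0.
by rewrite !pairingZ -mulrBr normrM -mulrA ler_wpM2l// dual_norm_ub.
Qed.

Lemma dual_normZ (l : R) f : dual_norm (l *: f) = `|l| * dual_norm f.
Proof.
apply/eqP; rewrite eq_le dual_normZ_le /=.
have [->|l0] := eqVneq l 0; first by rewrite normr0 mul0r dual_norm_ge0.
have := dual_normZ_le l^-1 (l *: f); rewrite scalerA mulVf// scale1r.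
by rewrite normfV ler_pdivlMl ?normr_gt0.
Qed.

Lemma pairingxx f (x : X) : pairing f (x, x) = 0.
Proof.
have [M M0 /(_ x x)] := pairing_bounded f.
by rewrite mdistxx mulr0 normr_le0 => /eqP.
Qed.

Lemma dual_norm0_eq0 f : dual_norm f = 0 -> f = 0.
Proof.
move=> f0; apply: pairing_ext => -[a b]; change (pairing f (a, b) = 0).
have [->|nab] := eqVneq a b; first exact: pairingxx.
have ne : (a, a) <> (b, a) by case => /eqP; rewrite (negbTE nab).
have := dual_norm_ub f ne.
rewrite f0 pairingxx subr0 ler_pdivrMr ?mdistD_gt0// mul0r normr_le0.
by move/eqP.
Qed.

HB.instance Definition _ := Lmodule_isNormed.Build R linear_dual
  dual_normD dual_normZ dual_norm0_eq0.

End dual.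

Section functions.
Context {R : realType} (X : hadamardType R).
Local Notation XD := (linear_dual X).
Local Open Scope ereal_scope.
Implicit Types (h : X * XD -> \bar R) (p : X).

Definition proper_fun h : Prop :=
  (forall z, h z <> -oo) /\ exists z, h z <> +oo.

Definition epigraph h : set (X * XD * R) := [set w | h w.1 <= w.2%:E].

Definition lsc_fun h : Prop := closed (epigraph h).

Definition convex_fun h : Prop :=
  forall (z w : X * XD) (l : R), (0 <= l <= 1)%R ->
    h (gcomb z.1 w.1 l, (1 - l) *: z.2 + l *: w.2)%R
    <= (1 - l)%:E * h z + l%:E * h w.

Definition Gamma : set (X * XD -> \bar R) :=
  [set h | [/\ proper_fun h, lsc_fun h & convex_fun h]].

Definition coupling p (z : X * XD) : R := pairing z.2 (p, z.1).

Definition flip (z : X * XD) : XD * X := (z.2, z.1).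

Definition indicator (A : set (X * XD)) (z : X * XD) : \bar R :=
  if `[< A z >] then 0 else +oo.

Definition fenchel p h : XD * X -> \bar R := fun w =>
  ereal_sup [set (pairing w.1 (p, y.1) + pairing y.2 (p, w.2))%:E - h y
            | y in [set: X * XD]].

Definition below_coupling p h : set (X * XD) :=
  [set z | h z <= (coupling p z)%:E].

Definition Gamma_dual p : set (X * XD -> \bar R) :=
  [set h | Gamma h /\
     h = fenchel p (h \+ indicator (below_coupling p h)) \o flip].

End functions.

Section operators.
Context {R : realType} (X : hadamardType R).
Local Notation XD := (linear_dual X).
Implicit Types T : X -> set XD.

Definition gra T : set (X * XD) := [set z | T z.1 z.2].

Definition monotone_op T : Prop :=
  forall z w, gra T z -> gra T w -> 0 <= pairing (z.2 - w.2) (w.1, z.1).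

Definition maximal_monotone T : Prop :=
  monotone_op T /\ forall T', monotone_op T' -> ~ (gra T `<` gra T').

Definition coincidence_op (h : X * XD -> \bar R) (p : X) : X -> set XD :=
  fun x => [set x' | h (x, x') = (coupling p (x, x'))%:E].

End operators.

(* Main.v *)
Require Import Defs.
From mathcomp Require Import all_boot all_order all_algebra.
From mathcomp Require Import all_classical all_reals all_analysis.
From mathcomp Require Import ring lra.

(** On the set [A] where [h <= pi_p], the identity [h = (h + iota_A)^* o r] is
    the Fenchel-Young inequality [<x', py> + <y', px> <= h x x' + h y y'] for
    [(y, y')] in [A]. Its diagonal case gives [h >= pi_p] on [A], so [A] is the
    graph of the operator, and its general case on [A] is monotonicity. A point
    monotonically related to [A] makes every term of the supremum defining [h]
    there at most [pi_p], so it lies in [A]. *)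

Set Implicit Arguments.
Unset Strict Implicit.
Unset Printing Implicit Defensive.

Import Order.TTheory GRing.Theory Num.Theory.
Local Open Scope classical_set_scope.
Local Open Scope ring_scope.

Section pairing_chasles.
Context {R : realType} (X : hadamardType R).

Lemma quasilin_chasles (ab : X * X) (x y z : X) :
  quasilin ab (x, z) = quasilin ab (x, y) + quasilin ab (y, z).
Proof. by rewrite /quasilin /=; ring. Qed.

(** Squared distances telescope in each quasilinearization, and this passes to finite linear
    combinations. *)
Lemma pairing_chasles (f : linear_dual X) (x y z : X) :
  pairing f (x, z) = pairing f (x, y) + pairing f (y, z).
Proof.
case: f => f /=; rewrite inE => -[n [a [g [gd ->]]]]; rewrite /pairing /=.
rewrite !fct_sumE -big_split /=; apply: eq_bigr => i _.
have [t [ab ->]] := gd i.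
change (a i * (t * quasilin ab (x, z)) =
  a i * (t * quasilin ab (x, y)) + a i * (t * quasilin ab (y, z))).
by rewrite (quasilin_chasles ab x y z); ring.
Qed.

(** Splitting the segment from [w.1] to [z.1] at [p] turns the monotonicity inequality into a
    Fenchel-Young one. *)
Lemma pairing_coupling (p : X) (z w : X * linear_dual X) :
  pairing (z.2 - w.2) (w.1, z.1) =
  coupling p z + coupling p w - (pairing z.2 (p, w.1) + pairing w.2 (p, z.1)).
Proof.
rewrite pairingB /coupling (pairing_chasles z.2 p w.1 z.1).
by rewrite (pairing_chasles w.2 p w.1 z.1); ring.
Qed.

End pairing_chasles.

Section gamma_dual.
Context {R : realType} (X : hadamardType R) (p : X).
Context (h : X * linear_dual X -> \bar R) (hh : Gamma_dual p h).
Local Open Scope ereal_scope.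

Lemma Gamma_dual_young z w : below_coupling p h w ->
  (pairing z.2 (p, w.1) + pairing w.2 (p, z.1))%:E - h w <= h z.
Proof.
(* [h] also occurs inside its own conjugate, so [hE] is evaluated at [z] and used on one side
   only. *)
move=> Aw; have [_ hE] := hh; rewrite [leRHS](congr1 (@^~ z) hE).
apply: ereal_sup_ubound; exists w => //=.
by rewrite /indicator asboolT// adde0.
Qed.

Lemma below_couplingE z : below_coupling p h z = (h z = (coupling p z)%:E).
Proof.
apply/propext; split=> [Az|]; last by rewrite /below_coupling /= => ->.
have [[[hNoo _] _ _] _] := hh; have := Gamma_dual_young z Az.
move: Az (hNoo z); rewrite /below_coupling /=.
(* Properness excludes [-oo] and [Az] excludes [+oo]; for finite [r], [young] reads
   [2 * coupling p z - r <= r]. *)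
case: (h z) => [r| |//]; last by rewrite leye_eq.
rewrite -EFinB !lee_fin /coupling => below _ young.
by congr EFin; lra.
Qed.

Lemma gra_coincidence_op : gra (coincidence_op h p) = below_coupling p h.
Proof. by apply/funext => -[x x']; rewrite below_couplingE. Qed.

Lemma coincidence_op_monotone : monotone_op (coincidence_op h p).
Proof.
rewrite /monotone_op gra_coincidence_op => z w Az Aw.
have := Gamma_dual_young z Aw.
move: Az Aw; rewrite !below_couplingE => -> ->.
by rewrite (pairing_coupling p) -EFinB lee_fin; lra.
Qed.

Lemma below_coupling_related z :
  (forall w, below_coupling p h w ->
    (0 <= pairing (z.2 - w.2) (w.1, z.1))%R) ->
  below_coupling p h z.
Proof.
move=> zA; have [[[hNoo _] _ _] hE] := hh.
rewrite /below_coupling /= [leLHS](congr1 (@^~ z) hE).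
apply: ge_ereal_sup => _ [w _ <-] /=; rewrite /indicator.
case: asboolP => [Aw|_].
  have := zA _ Aw; move: Aw; rewrite below_couplingE => ->.
  by rewrite (pairing_coupling p) adde0 -EFinB lee_fin; lra.
(* Off the set, [h w + +oo] is [+oo] because [h w] is not [-oo], so the term is [-oo]. *)
by rewrite addey ?leNye//; apply/eqP; exact: hNoo.
Qed.

End gamma_dual.

Theorem theorem5p14 (R : realType) (X : hadamardType R) (p : X)
    (h : X * linear_dual X -> \bar R) (hh : Gamma_dual p h) :
  maximal_monotone (coincidence_op h p).
Proof.
split=> [|T mT [sub nsub]]; first exact: coincidence_op_monotone.
(* The graph of [T] contains the set, so monotonicity of [T] relates [z] to all of it. *)
apply: nsub => z Tz; rewrite gra_coincidence_op//.
apply: below_coupling_related => // w Aw; apply: mT => //.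
by apply: sub; rewrite gra_coincidence_op.
Qed.
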